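(* Let $h:[0,\infty)\to[0,\infty)$ be measurable with $\alpha:=\int_0^\infty h(t)\,dt<1$. Let $N_R$ be a renewal process with epochs $S_0=0$, $S_n=\tau_1+\dots+\tau_n$, where $\tau_1,\tau_2,\dots$ are positive i.i.d. random variables with finite mean $m^{-1}$ whose common distribution function $F$ has a density $f$; let $N_R$ be independent of the offspring families $\{N_s^{(n)}(\cdot\mid t):t\in[0,\infty)\}_{n\ge1}$ associated with $h$. Then the cluster process $$N(\cdot)=\int_0^\infty N_c(\cdot\mid t)\,N_R(dt)=\sum_{t_0\in N_R(\cdot)}\ \sum_{n\ge0}N_c^{(n)}(\cdot\mid t_0)$$ exists and has almost surely finite clusters.
   Context: Point processes are random locally finite counting measures; $t\in N(\cdot)$ means that $t$ runs over the points of $N$. The renewal process is identified with its counting process $N_R(t)=\sum_{i\ge0}1_{\{S_i\le t\}}$ (so the epoch $S_0=0$ is counted). Offspring families: set $h(x)=0$ for $x<0$. For $t\ge0$, $N_s(\cdot\mid t)$ denotes an inhomogeneous Poisson process with intensity measure $h(x-t)\,dx$. The families $\{N_s^{(n)}(\cdot\mid t):t\in[0,\infty)\}$, $n\ge1$, are i.i.d. in $n$; for each $n$ the processes $N_s^{(n)}(\cdot\mid t)$, $t\ge 0$, are mutually independent, with $N_s^{(n)}(\cdot\mid t)\overset{d}{=}N_s(\cdot\mid t)$. Generations: given an immigrant at $t_0\ge0$, define recursively $$N_c^{(0)}(\cdot\mid t_0)=\delta_{t_0},\qquad N_c^{(n+1)}(\cdot\mid t_0)=\sum_{t\in N_c^{(n)}(\cdot\mid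 t_0)}N_s^{(n+1)}(\cdot\mid t),\quad n\ge0,$$ and the cluster $N_c(\cdot\mid t_0)=\sum_{n\ge0}N_c^{(n)}(\cdot\mid t_0)$. Such superpositions are understood in law as independent superpositions: conditionally on the centre points, the processes attached to distinct centres are independent with the prescribed laws; in particular, given $N_R$, the clusters attached to its points are independent. The cluster process $N$ ''exists'' if $N(B)<\infty$ a.s. for every bounded Borel set $B\subset\mathbb{R}$. ''Almost surely finite clusters'' means $N_c([0,\infty)\mid t_0)<\infty$ a.s. for each $t_0\ge 0$. *)

(* Defs.v *)
From HB Require Import structures.
From mathcomp Require Import all_boot all_order all_algebra.
From mathcomp Require Import all_classical all_reals all_analysis.
From mathcomp Require Import measurable_realfun giry.

Set Implicit Arguments.
Unset Strict Implicit.
Unset Printing Implicit Defensive.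

Import Order.TTheory GRing.Theory Num.Theory.
Import numFieldNormedType.Exports.

Local Open Scope classical_set_scope.
Local Open Scope ring_scope.
Local Open Scope ereal_scope.

(* Borel measures on the line, with the sigma-algebra generated by the
   evaluations mu |-> mu B, B Borel (same construction as [giry], without the
   bound on the mass). *)
Section measures.
Variable R : realType.

Definition measures : Type := {measure set R -> \bar R}.

HB.instance Definition _ := gen_eqMixin measures.
HB.instance Definition _ := gen_choiceMixin measures.
HB.instance Definition _ := isPointed.Build measures mzero.

Definition measures_measurable : set_system measures :=
  <<s \bigcup_(B in (measurable : set (set R)))
        preimage_set_system [set: measures] (fun mu : measures => mu B)
          (measurable : set (set (\bar R))) >>.

Let measures_measurable0 : measures_measurable set0.
Proof. exact: sigma_algebra0. Qed.

Let measures_measurableC U : measures_measurable U ->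
  measures_measurable (~` U).
Proof. exact: sigma_algebraC. Qed.

Let measures_measurableU (F : (set measures)^nat) :
  (forall i, measures_measurable (F i)) -> measures_measurable (\bigcup_i F i).
Proof. exact: sigma_algebra_bigcup. Qed.

Definition measures_display : measure_display.
Proof. by constructor. Qed.

HB.instance Definition _ :=
  @isMeasurable.Build measures_display measures measures_measurable
    measures_measurable0 measures_measurableC measures_measurableU.

End measures.

Section independence.
Context d (Omega : measurableType d) (R : realType) (P : probability Omega R).

Definition mutually_independent (I : choiceType) (D : set I)
    (G : I -> set_system Omega) : Prop :=
  forall (s : seq I) (A : I -> set Omega), uniq s ->
    (forall i, i \in s -> D i /\ G i (A i)) ->
    P (\bigcap_(i in [set` s]) A i) = \prod_(i <- s) P (A i).

Definition independent2 (G H : set_system Omega) : Prop :=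
  forall A B, G A -> H B -> P (A `&` B) = P A * P B.

(* sigma-algebra generated by the random elements X i, i in D *)
Definition sigma_family (I : Type) (D : set I) d' (T : measurableType d')
    (X : I -> Omega -> T) : set_system Omega :=
  <<s \bigcup_(i in D) g_sigma_algebra_preimage (X i) >>.

End independence.

Section point_processes.
Context d (Omega : measurableType d) (R : realType) (P : probability Omega R).
Implicit Types (N C : Omega -> measures R) (B : set R).

Definition point_process N : Prop :=
  measurable_fun [set: Omega] N /\
  forall w B, measurable B -> bounded_set B ->
    exists k : nat, N w B = k%:R%:E.

(* [poisson_prob] rather than [poisson_pmf], which is 1 everywhere at rate 0;
   the second argument of [poisson_prob] is a dummy. *)
Definition poisson_process (Lambda : set R -> \bar R) N : Prop :=
  [/\ point_process N,
      (forall B (k : nat), measurable B -> Lambda B < +oo ->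
         P [set w | N w B = k%:R%:E] =
         poisson_prob (fine (Lambda B)) 0 [set k])
    & (forall B_ : (set R)^nat,
         (forall i, measurable (B_ i)) -> trivIset setT B_ ->
         mutually_independent P [set: nat]
           (fun i => g_sigma_algebra_preimage (fun w => N w (B_ i))))].

(* h(x - t) dx, where h is extended by 0 to the negative half-line *)
Definition offspring_intensity (h : R -> R) (t : R) (B : set R) : \bar R :=
  \int[lebesgue_measure]_(x in B) ((h \_ `[0%R, +oo[) (x - t)%R)%:E.

(* The families N_s^(n)(. | t) for n >= 1 and t >= 0; Ns 0 and Ns n t with
   t < 0 are irrelevant.  Mutual independence and equality of the marginal laws
   make the families identically distributed in n. *)
Definition offspring_families (h : R -> R)
    (Ns : nat -> R -> Omega -> measures R) : Prop :=
  [/\ (forall n t, (0 < n)%N -> (0 <= t)%R ->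
         poisson_process (offspring_intensity h t) (Ns n t)),
      (forall n, (0 < n)%N ->
         mutually_independent P (`[0%R, +oo[ : set R)
           (fun t => g_sigma_algebra_preimage (Ns n t)))
    & mutually_independent P [set n : nat | (0 < n)%N]
        (fun n => sigma_family `[0%R, +oo[ (Ns n))].

Definition epoch (tau : nat -> Omega -> R) (n : nat) (w : Omega) : R :=
  (\sum_(i < n) tau i w)%R.

Definition renewal_process (tau : nat -> Omega -> R) : Omega -> measures R :=
  fun w => mseries (fun n => \d_(epoch tau n w) : measures R) 0.

(* A point that may be absent (None), as a unit mass or the null measure. *)
Definition point_mass (x : option R) : measures R :=
  if x is Some t then \d_t else mzero.

(* Law of the process attached to a centre: the law of K t at a present centre
   t, the null measure at an absent one. *)
Definition attached_law (K : R -> Omega -> measures R) (x : option R)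
    (E : set (measures R)) : \bar R :=
  if x is Some t then P (K t @^-1` E) else \d_(mzero : measures R) E.

(* N is the superposition of processes M k attached to the points X k of C:
   conditionally on the sigma-algebra G, for which the centres are measurable,
   the M k are independent and M k has the law of K t at the centre X k = t.
   X enumerates the points of C with multiplicity; None pads finite
   configurations.  Independence is only required conditionally because a
   pathwise sum of w |-> K t w over random t is not meaningful when (K t)_t is
   an uncountable family of independent processes. *)
Definition independent_superposition (G : set_system Omega) C
    (K : R -> Omega -> measures R) (X : nat -> Omega -> option R)
    (M : nat -> Omega -> measures R) N : Prop :=
  [/\ (forall k B, measurable B -> G [set w | exists2 x, B x & X k w = Some x]),
      {ae P, forall w, C w ≡μ mseries (fun k => point_mass (X k w)) 0},
      (forall k, measurable_fun [set: Omega] (M k)),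
      (forall A (E : (set (measures R))^nat) (r : nat),
         G A -> (forall k, measurable (E k)) ->
         P (A `&` \bigcap_(k in `I_r) (M k @^-1` E k)) =
         \int[P]_(w in A) \prod_(k < r) attached_law K (X k w) (E k))
    & {ae P, forall w, N w ≡μ mseries (fun k => M k w) 0}].

(* Nc n is the n-th generation of the cluster of an immigrant at t0.  F n
   records generations 0 to n, so that the offspring processes of
   generation n + 1 are independent of the past given the points of
   generation n. *)
Definition cluster_generations (Ns : nat -> R -> Omega -> measures R) (t0 : R)
    (Nc : nat -> Omega -> measures R) : Prop :=
  [/\ (forall n, measurable_fun [set: Omega] (Nc n)),
      (forall w, Nc 0%N w ≡μ (\d_t0 : measures R))
    & exists (F : nat -> set_system Omega) (X : nat -> nat -> Omega -> option R)
        (M : nat -> nat -> Omega -> measures R),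
      [/\ (forall n, sigma_algebra setT (F n) /\ F n `<=` measurable),
          (forall n, F n `<=` F n.+1),
          (forall n k, g_sigma_algebra_preimage (M n k) `<=` F n.+1)
        & (forall n, independent_superposition (F n) (Nc n) (Ns n.+1)
                       (X n) (M n) (Nc n.+1))]].

Definition whole_cluster (Nc : nat -> R -> Omega -> measures R) (t0 : R) :
    Omega -> measures R :=
  fun w => mseries (fun n => Nc n t0 w) 0.

(* N is the superposition, over the points of NR, of clusters that are
   independent given NR. *)
Definition cluster_process NR (Nc : nat -> R -> Omega -> measures R) N : Prop :=
  measurable_fun [set: Omega] N /\
  exists (X : nat -> Omega -> option R) (M : nat -> Omega -> measures R),
    independent_superposition (g_sigma_algebra_preimage NR) NR (whole_cluster Nc)
      X M N.

End point_processes.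

(* Main.v *)
(* Every individual in a cluster has a Poisson number of children with mean
   alpha < 1, so generation n has mean size at most alpha^n and the total size of
   a cluster has mean at most 1 / (1 - alpha): clusters are almost surely finite.
   Only the total mass of the offspring processes enters, and it is Poisson(alpha)
   whatever the centre.  Clusters live to the right of their immigrant, and the
   renewal process has finitely many points in each interval ]-oo, b] because
   almost surely infinitely many waiting times exceed a fixed e > 0; hence N
   restricted to ]-oo, b] is a finite sum of finite clusters. *)
Require Import Defs.
From HB Require Import structures.
From mathcomp Require Import all_boot all_order all_algebra.
From mathcomp Require Import all_classical all_reals all_analysis.
From mathcomp Require Import measurable_realfun giry ring.

Set Implicit Arguments.
Unset Strict Implicit.
Unset Printing Implicit Defensive.

Import Order.TTheory GRing.Theory Num.Theory.
Import numFieldNormedType.Exports.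

Local Open Scope classical_set_scope.
Local Open Scope ring_scope.
Local Open Scope ereal_scope.

(** * Measurability in the space of measures *)

Section measures_evaluation.
Context (R : realType).

Lemma measurable_measures_ev (B : set R) : measurable B ->
  measurable_fun [set: measures R] (fun mu : measures R => mu B).
Proof.
move=> mB.
apply: (@measurability _ _ (measures R) _ setT _ measurable).
  by rewrite smallest_id//; exact: sigma_algebra_measurable.
apply: subset_trans; last exact: sub_gen_smallest.
exact: (bigcup_sup mB).
Qed.

Lemma measurable_fun_measures d (T : measurableType d) (f : T -> measures R) :
  (forall B, measurable B -> measurable_fun setT (fun w => f w B)) ->
  measurable_fun setT f.
Proof.
move=> mf.
apply: (measurability (\bigcup_(B in (measurable : set (set R)))
  preimage_set_system [set: measures R] (fun mu : measures R => mu B)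
    (measurable : set (set (\bar R))))) => //= _ [_ [C mC [Z mZ] <-] <-].
by rewrite setTI; exact: mf.
Qed.

Lemma measurable_measures_preimage (B : set R) (E : set (\bar R)) :
  measurable B -> measurable E -> measurable [set mu : measures R | E (mu B)].
Proof.
by move=> mB mE; rewrite -[X in measurable X]setTI; exact: measurable_measures_ev.
Qed.

Lemma measurable_measures_neq0 (B : set R) : measurable B ->
  measurable [set mu : measures R | mu B != 0].
Proof.
move=> mB; apply: (measurable_measures_preimage mB (E := [set x | x != 0])).
rewrite (_ : [set x | _] = ~` [set 0]); first exact: measurableC.
by apply/seteqP; split => x /eqP.
Qed.

End measures_evaluation.

(** * Series of nonnegative extended reals *)

Section nonnegative_series.
Context (R : realType).
Implicit Types u : (\bar R)^nat.

Lemma nneseries_lty u N : (forall k, 0 <= u k) -> (forall k, u k < +oo) ->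
  (forall k, (N <= k)%N -> u k = 0) -> \sum_(0 <= k <oo) u k < +oo.
Proof.
move=> u0 uoo uN; rewrite (nneseries_split 0%N N)// add0n.
rewrite (eseries0 (P := xpredT) (N := N)); last by move=> k Nk _; apply: uN.
by rewrite adde0; apply/lte_sum_pinfty => k _; exact: uoo.
Qed.

(** The tails of a convergent series tend to 0, whereas a tail that contains a true [p k] is at
    least 1. Applied to the indicators of the centres, it turns a finite count into a last index. *)
Lemma nneseries_bool_eventually0 (p : nat -> bool) :
  \sum_(0 <= k <oo) (p k)%:R%:E < (+oo : \bar R) ->
  exists N, forall k, (N <= k)%N -> ~~ p k.
Proof.
move=> poo; have p0 k : 0 <= ((p k)%:R%:E : \bar R) by rewrite lee_fin.
apply: contrapT => noN.
have : (1%:E : \bar R) <= 0.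
  apply: (cvge_to_ge (nneseries_tail_cvg poo (fun k _ => p0 k))).
  apply: nearW => N; rewrite leNgt; apply/negP => tailN.
  apply: noN; exists N => k Nk; apply/negP => pk.
  move: tailN; rewrite ltNge => /negP; apply.
  apply: le_trans (nneseries_lim_ge k.+1 _); last by move=> n _ _; exact: p0.
  by rewrite big_nat_recr//= pk leeDr// sume_ge0.
by rewrite lee_fin ler10.
Qed.

End nonnegative_series.

(** * The mean of the Poisson law *)

Section poisson_mean.
Context (R : realType).

Lemma nneseries_poisson (r : R) :
  \sum_(0 <= j <oo) poisson_prob r 0 [set j] = 1.
Proof.
have := probability_setT (poisson_prob r 0).
have -> : [set: nat] = \bigcup_j [set j] by apply/seteqP; split => // x _; exists x.
rewrite measure_bigcup//=; first by move=> <-; under [RHS]eq_eseriesl do rewrite in_setT.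
by move=> i j _ _ [x []] /= -> ->.
Qed.

Lemma poisson_mean (r : R) : (0 <= r)%R ->
  \sum_(0 <= j <oo) j%:R%:E * poisson_prob r 0 [set j] = r%:E.
Proof.
rewrite le_eqVlt => /predU1P[<-|r0].
  (* At rate 0, [poisson_prob] is the Dirac mass at 0. *)
  rewrite eseries0// => j _ _; rewrite /poisson_prob ltxx diracE.
  by case: j => [|j]; rewrite ?mul0e// memNset ?mule0.
transitivity (r%:E * \sum_(0 <= j <oo) poisson_prob r 0 [set j]); last first.
  by rewrite nneseries_poisson mule1.
have ge0 j : 0 <= j%:R%:E * poisson_prob r 0 [set j] by rewrite mule_ge0.
(* The term of index 0 vanishes, and (j+1) r^(j+1) / (j+1)! = r (r^j / j!) matches the remaining
   terms with r times the Poisson weights, whose sum is 1. *)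
rewrite -nneseriesZl// nneseries_recl//.
rewrite mul0e add0e -nneseries_addn//.
apply: eq_eseriesr => j _; rewrite /poisson_prob r0 !esum_set1 ?lee_fin ?poisson_pmf_ge0//.
rewrite /poisson_pmf r0 -!EFinM addn1 factS natrM exprS; congr EFin.
have j1 : (1 + j%:R != 0 :> R)%R by rewrite nat1r pnatr_eq0.
have jf : (j`!%:R != 0 :> R)%R by rewrite pnatr_eq0 -lt0n fact_gt0.
by field; rewrite jf j1.
Qed.

End poisson_mean.

(** * The offspring intensity: translation invariance and support *)

Section offspring_intensity.
Context (R : realType) (h : R -> R).
Hypothesis hm : measurable_fun (`[0%R, +oo[ : set R) h.
Hypothesis h0 : forall x : R, (0 <= x)%R -> (0 <= h x)%R.

Let shift (t x : measurableTypeR R) : measurableTypeR R := (x - t)%R.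

Let measurable_shift t : measurable_fun setT (shift t).
Proof. exact: measurable_funB. Qed.

HB.instance Definition _ t :=
  isMeasurableFun.Build _ _ _ _ (shift t) (measurable_shift t).

(** By uniqueness of Lebesgue measure, it is enough to compare both measures on half-open intervals,
    whose length a translation preserves. *)
Lemma lebesgue_measure_shift (t : R) (A : set R) : measurable A ->
  lebesgue_measure A = pushforward lebesgue_measure (shift t) A.
Proof.
move=> mA.
apply: lebesgue_measure_unique => //= _ [[a b]] _ <-.
rewrite /pushforward/=.
have -> : shift t @^-1` `]a, b] = `](a + t)%R, (b + t)%R]%classic.
  by apply/seteqP; split => x /=; rewrite /shift !in_itv/= ltrBrDr lerBlDr.
rewrite !lebesgue_measure_itv/= !lte_fin ltrD2r; case: ifPn => // _.
by rewrite -!EFinD opprD addrACA subrr addr0.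
Qed.

Lemma ge0_integral_shift (t : R) (f : R -> \bar R) : measurable_fun setT f ->
  (forall x, 0 <= f x) ->
  \int[lebesgue_measure]_x f (x - t)%R = \int[lebesgue_measure]_x f x.
Proof.
move=> mf f0; rewrite (@eq_measure_integral _ _ _ setT
  (pushforward lebesgue_measure (shift t)) lebesgue_measure f); last first.
  by move=> A mA _; apply: lebesgue_measure_shift.
by rewrite ge0_integral_pushforward.
Qed.

(** Translation invariance removes the centre: the mean number of children does not depend on
    [t]. *)
Lemma offspring_intensity_setT (t : R) :
  offspring_intensity h t setT = \int[lebesgue_measure]_(x in `[0%R, +oo[) (h x)%:E.
Proof.
rewrite /offspring_intensity.
rewrite (ge0_integral_shift t (f := fun x => ((h \_ `[0%R, +oo[) x)%:E)); first last.
- move=> x; rewrite lee_fin; apply: restrict_ge0 => y.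
  by rewrite /= in_itv/= andbT; exact: h0.
- by apply/measurable_EFinP; apply/measurable_restrict => //; rewrite setIidr.
by rewrite [RHS]integral_mkcond restrict_EFin.
Qed.

Lemma offspring_intensity_lt (t s : R) : (s <= t)%R ->
  offspring_intensity h t `]-oo, s[ = 0.
Proof.
move=> st; apply: integral0_eq => x /=; rewrite in_itv/= => xs.
by rewrite patchE memNset//= in_itv/= andbT subr_ge0 leNgt (lt_le_trans xs st).
Qed.

End offspring_intensity.

(** * Independent superpositions: centres and attached processes *)

Definition located (T : Type) (R : realType) (X : nat -> T -> option R) (k : nat)
  (B : set R) : set T := [set w | exists2 x, B x & X k w = Some x].

Section superposition.
Context d (Omega : measurableType d) (R : realType) (P : probability Omega R).
Variables (G : set_system Omega) (C : Omega -> measures R)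
  (K : R -> Omega -> measures R) (X : nat -> Omega -> option R)
  (M : nat -> Omega -> measures R) (N : Omega -> measures R).
Hypothesis sG : sigma_algebra setT G.
Hypothesis mG : G `<=` measurable.
Hypothesis supN : independent_superposition P G C K X M N.

Let GC A : G A -> G (~` A).
Proof. by case: sG => _ GD _ /GD; rewrite setTD. Qed.

Let G_located k B : measurable B -> G (located X k B).
Proof. by move=> mB; case: supN => H _ _ _ _; exact: H. Qed.

Let measurable_located k B : measurable B -> measurable (located X k B).
Proof. by move=> mB; exact/mG/G_located. Qed.

Let measurable_attached k : measurable_fun setT (M k).
Proof. by case: supN. Qed.

Let measurable_attached_preimage k E : measurable E -> measurable (M k @^-1` E).
Proof. by move=> mE; rewrite -[X in measurable X]setTI; exact: measurable_attached. Qed.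

Lemma attached_lawT x : attached_law P K x setT = 1.
Proof. by case: x => [t|] /=; rewrite ?preimage_setT ?probability_setT// diracT. Qed.

Lemma attached_marginal k A E : G A -> measurable E ->
  P (A `&` M k @^-1` E) = \int[P]_(w in A) attached_law P K (X k w) E.
Proof.
move=> GA mE; case: supN => _ _ _ indep _.
(* Only index [k] is constrained; the other factors are laws of the whole space, hence 1. The bound
   [k.+1] is the least that includes [k]. *)
have := indep A (fun j => if j == k then E else setT) k.+1 GA.
have -> : \bigcap_(j in `I_k.+1) (M j @^-1` (if j == k then E else setT)) = M k @^-1` E.
  apply/seteqP; split => [w /(_ k (ltnSn k))|w MkE j /= _]; rewrite /= ?eqxx//.
  by case: eqP => // ->.
move=> -> //; last by move=> j; case: ifP.
apply: eq_integral => w _; rewrite big_ord_recr/= eqxx big1 ?mul1e// => i _.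
by rewrite ltn_eqF ?attached_lawT.
Qed.

(* The integrand is not assumed measurable: the marginal law is only used on
   events of [G] where it is constant. *)
Lemma attached_marginal_cst k A E (c : \bar R) : G A -> measurable E ->
  (forall w, A w -> attached_law P K (X k w) E = c) ->
  P (A `&` M k @^-1` E) = c * P A.
Proof.
move=> GA mE lawE; rewrite attached_marginal//.
rewrite (eq_integral (cst c)) ?integral_cst//; first exact: mG.
by move=> w /set_mem; exact: lawE.
Qed.

Lemma attached_negligible k D E : measurable D -> measurable E ->
  ~ E (mzero : measures R) -> (forall t, D t -> P (K t @^-1` E) = 0) ->
  P.-negligible (~` located X k (~` D) `&` M k @^-1` E).
Proof.
move=> mD mE E0 KE; have mC := measurableC mD.
apply/negligibleP.
  apply: measurableI; last exact: measurable_attached_preimage.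
  exact/measurableC/measurable_located.
rewrite -[RHS](mul0e (P (~` located X k (~` D)))).
apply: attached_marginal_cst => //; first exact/GC/G_located.
move=> w /= nD; case XE: (X k w) => [t|] /=; last by rewrite diracE memNset.
by apply: KE; apply: contrapT => Dt; apply: nD; exists t.
Qed.

Lemma centre_count B : measurable B ->
  {ae P, forall w, C w B = \sum_(0 <= k <oo) (\1_(located X k B) w)%:E}.
Proof.
move=> mB; case: supN => _ + _ _ _.
apply: filterS => w /(_ _ mB) ->; apply: eq_eseriesr => k _.
rewrite indicE; case XE: (X k w) => [t|] /=.
  rewrite diracE; congr (_%:R%:E)%E; congr nat_of_bool.
  by apply/idP/idP => /set_mem => [Bt|[x Bx]]; rewrite inE/=; [exists t|rewrite XE => -[->]].
by rewrite memNset//= => -[x _]; rewrite XE.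
Qed.

(** A centre in [B] contributes 1 to the series of [centre_count], so that the count cannot be 0. *)
Lemma centre_located_negligible k B : measurable B ->
  {ae P, forall w, C w B = 0} -> P.-negligible (located X k B).
Proof.
move=> mB C0.
suff : {ae P, forall w, ~ located X k B w} by apply: negligibleS => w /= Lw; exact.
apply: filterS2 C0 (centre_count mB) => w -> /esym S0 Lw.
have := @nneseries_lim_ge R (fun k => (\1_(located X k B) w)%:E) xpredT 0 k.+1.
rewrite S0 big_nat_recr//= (indicE _ (located X k B)) mem_set// => H.
have : 1%:E <= 0 :> \bar R.
  apply: le_trans (H _); last by move=> j _ _; rewrite lee_fin.
  by rewrite leeDr// sume_ge0// => j _; rewrite lee_fin.
by rewrite lee_fin ler10.
Qed.

Lemma expected_centre_count B : measurable B -> measurable_fun setT C ->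
  \int[P]_w C w B = \sum_(0 <= k <oo) P (located X k B).
Proof.
move=> mB mC.
have mL k : measurable_fun setT (fun w => (\1_(located X k B) w)%:E : \bar R).
  by apply/measurable_EFinP; apply: measurable_indic; exact: measurable_located.
rewrite (ae_eq_integral (fun w => \sum_(0 <= k <oo) (\1_(located X k B) w)%:E))//; first last.
- by apply: filterS (centre_count mB) => w + _.
- by apply: ge0_emeasurable_sum => // k w _ _; rewrite lee_fin.
- by apply: (measurableT_comp (measurable_measures_ev mB)).
rewrite integral_nneseries//.
by apply: eq_eseriesr => k _; rewrite integral_indic ?setIT//; exact: measurable_located.
Qed.

End superposition.

(** The Poisson weights sum to 1, so the events where [U] is a natural number already exhaust [A] up
    to a null set; integrating over them gives [P A] times the Poisson mean. The event [A] will be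
    that a given centre lies in a given set. *)
Lemma ge0_integral_poisson d (Omega : measurableType d) (R : realType)
    (P : probability Omega R) (A : set Omega) (U : Omega -> \bar R) (r : R) :
  measurable A -> measurable_fun setT U -> (forall w, 0 <= U w) -> (0 <= r)%R ->
  (forall j : nat, P (A `&` [set w | U w = j%:R%:E]) = P A * poisson_prob r 0 [set j]) ->
  \int[P]_(w in A) U w = r%:E * P A.
Proof.
move=> mA mU U0 r0 PU; pose F (j : nat) := A `&` [set w | U w = j%:R%:E].
have mF j : measurable (F j).
  apply: measurableI => //; rewrite -[X in measurable X]setTI.
  exact: (mU measurableT [set _]).
have tF : trivIset setT F.
  move=> i j _ _ [w [[_ /= Ui] [_ /= Uj]]]; apply/eqP.
  by rewrite -(eqr_nat R) -eqe -Ui -Uj.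
have mUF : measurable (\bigcup_j F j) by exact: bigcup_measurable.
have FA : \bigcup_j F j `<=` A by move=> w [j _ []].
have PUF : P (\bigcup_j F j) = P A.
  apply: etrans (measure_bigcup P setT F (fun j _ => mF j) tF) _.
  under eq_eseriesl do rewrite in_setT.
  rewrite (eq_eseriesr (fun j _ => PU j)) -(fineK (fin_num_measure P _ mA)).
  by rewrite nneseriesZl// nneseries_poisson mule1.
(* On the rest of [A], the values of [U] are not controlled, but this rest is null. *)
have PA0 : P (A `\` \bigcup_j F j) = 0.
  have -> : P (A `\` \bigcup_j F j) = P A - P (\bigcup_j F j).
    rewrite measureD ?setIidr//.
    by rewrite (le_lt_trans (probability_le1 _ _)) ?ltry.
  by rewrite PUF subee ?fin_num_measure.
rewrite (ge0_negligible_integral _ _ _ _ PA0)//; last 2 first.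
- exact: measurableD.
- exact: measurable_funTS.
rewrite setDD setIidr// ge0_integral_bigcup//; last exact: measurable_funTS.
transitivity (\sum_(0 <= j <oo) P A * (j%:R%:E * poisson_prob r 0 [set j])).
  apply: eq_eseriesr => j _.
  rewrite (eq_integral (cst j%:R%:E)) ?integral_cst//; last first.
    by move=> w /set_mem[].
  by rewrite muleCA -PU.
rewrite -(fineK (fin_num_measure P _ mA)) nneseriesZl.
  by rewrite poisson_mean// muleC.
by move=> j _; rewrite mule_ge0.
Qed.

(** * Null sets and mean mass of a superposition *)

Section superposition_mean.
Context d (Omega : measurableType d) (R : realType) (P : probability Omega R).
Variables (G : set_system Omega) (C : Omega -> measures R)
  (K : R -> Omega -> measures R) (X : nat -> Omega -> option R)
  (M : nat -> Omega -> measures R) (N : Omega -> measures R).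
Hypothesis sG : sigma_algebra setT G.
Hypothesis mG : G `<=` measurable.
Hypothesis supN : independent_superposition P G C K X M N.

(** For each index, the centre is almost surely absent or in [D], and then the attached process does
    not charge [B]; there are countably many indices. *)
Lemma superposition_null D B : measurable D -> measurable B ->
  {ae P, forall w, C w (~` D) = 0} ->
  (forall t, D t -> P (K t @^-1` [set mu | mu B != 0]) = 0) ->
  {ae P, forall w, N w B = 0}.
Proof.
move=> mD mB C0 KB.
have mE := measurable_measures_neq0 mB.
have M0 k : {ae P, forall w, M k w B = 0}.
  have n1 : P.-negligible (~` located X k (~` D) `&` M k @^-1` [set mu | mu B != 0]).
    by apply: (attached_negligible sG mG supN) => //=; rewrite eqxx.
  have n2 : P.-negligible (located X k (~` D)).
    by apply: (centre_located_negligible supN) => //; exact: measurableC.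
  apply: negligibleS (negligibleU n1 n2) => w /= /eqP MB.
  by have [L|L] := pselect (located X k (~` D) w); [right|left].
case: supN => _ _ _ _; apply: filterS2 (ae_foralln M0) => w M0w /(_ _ mB) ->.
by apply: eseries0 => k _ _; exact: M0w.
Qed.

(** A form of Wald's identity: the [k]-th attached process has mean mass [r] times the probability
    that its centre is in [D], and summing over [k] by Tonelli gives [r] times the mean number of
    centres in [D]. *)
Lemma superposition_poisson_mean D (r : R) : measurable D -> (0 <= r)%R ->
  measurable_fun setT C -> measurable_fun setT N ->
  {ae P, forall w, C w (~` D) = 0} ->
  (forall t (j : nat), D t ->
    P (K t @^-1` [set mu | mu setT = j%:R%:E]) = poisson_prob r 0 [set j]) ->
  \int[P]_w N w setT = r%:E * \int[P]_w C w D.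
Proof.
move=> mD r0 mC mN C0 KT.
have mMT k : measurable_fun setT (fun w => M k w setT).
  case: supN => _ _ mM _ _.
  exact: (measurableT_comp (measurable_measures_ev measurableT)).
have mL k B : measurable B -> measurable (located X k B).
  by case: supN => GL _ _ _ _ mB; exact/mG/GL.
have MT k : \int[P]_w M k w setT = r%:E * P (located X k D).
  have mE j : measurable [set mu : measures R | mu setT = j%:R%:E].
    exact: (measurable_measures_preimage measurableT (E := [set _])).
  rewrite -(@ge0_integral_poisson _ _ _ _ _ (fun w => M k w setT))//; first last.
  - move=> j; rewrite muleC.
    apply: (attached_marginal_cst mG supN _ (mE j)).
      by case: supN => GL _ _ _ _; exact: GL.
    by move=> w [t Dt ->] /=; exact: KT.
  - exact: mL.
  have mLD := mL k D mD.
  (* Off [located X k D] the centre is absent, so that the attached process is almost surely null,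
     or it lies outside [D], which is negligible. *)
  rewrite -(setUv (located X k D)) (ge0_integral_setU P mLD (measurableC mLD))//=;
    first last.
  - by rewrite disj_set2E setICr eqxx.
  - by rewrite setUv; exact: mMT.
  rewrite (ae_eq_integral (D := ~` located X k D) (cst 0)) ?integral0 ?adde0//.
  - exact/measurableC/mL.
  - exact: measurable_funTS.
  have mNE := measurable_measures_neq0 (R := R) measurableT.
  (* With [set0] in the role of [D], the event is that the centre is absent, and the condition on
     [K] is vacuous. *)
  have n1 : P.-negligible (~` located X k (~` set0) `&`
      M k @^-1` [set mu | mu setT != 0]).
    by apply: (attached_negligible sG mG supN) => //=; rewrite eqxx.
  have n2 : P.-negligible (located X k (~` D)).
    by apply: (centre_located_negligible supN) => //; exact: measurableC.
  apply: negligibleS (negligibleU n1 n2) => w /= /not_implyP[nD /eqP MB].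
  have [L|L] := pselect (located X k (~` D) w); [by right|left; split => //].
  by case=> x _ Xx; have [Dx|Dx] := pselect (D x); [apply: nD|apply: L]; exists x.
rewrite (ae_eq_integral (fun w => \sum_(0 <= k <oo) M k w setT))//; first last.
- by case: supN => _ _ _ _; apply: filterS => w /(_ _ measurableT) ->.
- exact: ge0_emeasurable_sum.
- exact: (measurableT_comp (measurable_measures_ev measurableT)).
rewrite integral_nneseries// (expected_centre_count mG supN)//.
by rewrite -nneseriesZl//; apply: eq_eseriesr => k _; exact: MT.
Qed.

End superposition_mean.

(** * Finiteness and location of a single cluster *)

Section clusters.
Context (R : realType) d (Omega : measurableType d) (P : probability Omega R).
Variable h : R -> R.
Hypothesis hm : measurable_fun (`[0%R, +oo[ : set R) h.
Hypothesis h0 : forall x : R, (0 <= x)%R -> (0 <= h x)%R.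
Hypothesis halpha : \int[lebesgue_measure]_(x in `[0%R, +oo[) (h x)%:E < 1.
Variable Ns : nat -> R -> Omega -> measures R.
Hypothesis Ns_offspring : offspring_families P h Ns.

Let alpha := fine (\int[lebesgue_measure]_(x in `[0%R, +oo[) (h x)%:E).

Let int_h_ge0 : 0 <= \int[lebesgue_measure]_(x in `[0%R, +oo[) (h x)%:E.
Proof. by apply: integral_ge0 => x; rewrite /= in_itv/= andbT lee_fin => /h0. Qed.

Let alpha_ge0 : (0 <= alpha)%R.
Proof. exact: fine_ge0. Qed.

Let alpha_lt1 : (alpha < 1)%R.
Proof.
rewrite -lte_fin fineK// ge0_fin_numE//.
by apply: lt_trans halpha _; exact: ltry.
Qed.

Lemma offspring_mass n t (j : nat) : (0 < n)%N -> (0 <= t)%R ->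
  P (Ns n t @^-1` [set mu | mu setT = j%:R%:E]) = poisson_prob alpha 0 [set j].
Proof.
move=> n0 t0; case: Ns_offspring => /(_ n t n0 t0)[_ + _] _ _.
move=> /(_ setT j measurableT); rewrite offspring_intensity_setT//; apply.
by apply: lt_trans halpha _; exact: ltry.
Qed.

(** The intensity of []-oo, s[] is 0, and a Poisson variable of rate 0 vanishes almost surely. *)
Lemma offspring_before n t s : (0 < n)%N -> (0 <= t)%R -> (s <= t)%R ->
  P (Ns n t @^-1` [set mu | mu `]-oo, s[%classic != 0]) = 0.
Proof.
move=> n0 t0 st; case: Ns_offspring => /(_ n t n0 t0)[[mN _] + _] _ _.
move=> /(_ `]-oo, s[%classic 0%N (measurable_itv _)).
rewrite offspring_intensity_lt// => /(_ (ltry _)).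
rewrite /poisson_prob ltxx diracE mem_set//= => PN.
set A := [set w | _] in PN.
have mA : measurable A.
  have mNB := measurableT_comp (measurable_measures_ev (measurable_itv `]-oo, s[)) mN.
  by rewrite -[A]setTI; exact: (mNB measurableT [set _]).
have -> : Ns n t @^-1` [set mu | mu `]-oo, s[%classic != 0] = ~` A.
  by apply/seteqP; split => w /= /eqP.
by rewrite probability_setC// PN subee.
Qed.

Section generations.
Variables (t0 : R) (Nc : nat -> Omega -> measures R).
Hypothesis t0_ge0 : (0 <= t0)%R.
Hypothesis Nc_generations : cluster_generations P Ns t0 Nc.

Let setC_after : ~` `[t0, +oo[%classic = `]-oo, t0[%classic :> set R.
Proof. by rewrite setCitvr. Qed.

Let measurable_generation n (B : set R) : measurable B ->
  measurable_fun setT (fun w => Nc n w B).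
Proof.
case: Nc_generations => mNc _ _ mB.
exact: (measurableT_comp (measurable_measures_ev mB)).
Qed.

(** By induction, the parents are almost surely at or after [t0], and no child precedes its
    parent. *)
Lemma generation_before n : {ae P, forall w, Nc n w `]-oo, t0[%classic = 0}.
Proof.
case: Nc_generations => mNc Nc0 [F [X [M [sF _ _ supF]]]].
elim: n => [|n ih].
  apply: aeW => w; rewrite (Nc0 w _ (measurable_itv _)) /= diracE memNset//=.
  by rewrite in_itv/= ltxx.
have [sFn mFn] := sF n.
apply: (superposition_null sFn mFn (supF n) (D := `[t0, +oo[%classic)) => //.
  by rewrite setC_after.
move=> t; rewrite /= in_itv/= andbT => t0t.
by apply: offspring_before => //; exact: le_trans t0t.
Qed.

(** Each generation multiplies the mean size by [alpha]. The superposition lemma counts the parents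
    in [[t0, +oo[], which the total size of generation [n] bounds; hence an inequality. *)
Lemma generation_mean n : \int[P]_w Nc n w setT <= (alpha ^+ n)%:E.
Proof.
have [mNc Nc0 [F [X [M [sF _ _ supF]]]]] := Nc_generations.
elim: n => [|n ih].
  rewrite expr0 (eq_integral (cst 1)) ?integral_cst ?mul1e//.
    exact: probability_le1.
  by move=> w _; rewrite (Nc0 w _ measurableT) /= diracT.
have [sFn mFn] := sF n.
rewrite (superposition_poisson_mean sFn mFn (supF n)
  (D := `[t0, +oo[%classic) (r := alpha))//.
- rewrite exprS EFinM lee_wpmul2l//; apply: le_trans ih.
  apply: ge0_le_integral => //; [exact: measurable_generation..|].
  by move=> w _; apply: le_measure; rewrite ?inE.
- by rewrite setC_after; exact: generation_before.
- move=> t j; rewrite /= in_itv/= andbT => t0t.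
  by apply: offspring_mass => //; exact: le_trans t0t.
Qed.

Lemma cluster_before :
  {ae P, forall w, mseries (fun n => Nc n w) 0 `]-oo, t0[%classic = 0}.
Proof.
apply: filterS (ae_foralln generation_before) => w Nc0.
by apply: eseries0 => n _ _; exact: Nc0.
Qed.

(** The total size is integrable, its mean being dominated by a geometric series, and an integrable
    function is almost everywhere finite. *)
Lemma cluster_finite : {ae P, forall w, mseries (fun n => Nc n w) 0 setT < +oo}.
Proof.
have mS : measurable_fun setT (fun w => \sum_(0 <= n <oo) Nc n w setT).
  by apply: ge0_emeasurable_sum => // n _; exact: measurable_generation.
have S0 w : 0 <= \sum_(0 <= n <oo) Nc n w setT by exact: nneseries_ge0.
have intS : P.-integrable setT (fun w => \sum_(0 <= n <oo) Nc n w setT).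
  apply/integrableP; split => //.
  under eq_integral do rewrite gee0_abs//.
  rewrite integral_nneseries//; last by move=> n; exact: measurable_generation.
  apply: (@le_lt_trans _ _ (\sum_(0 <= n <oo) (alpha ^+ n)%:E)).
    apply: lee_nneseries => [n _ _|n _]; first exact: integral_ge0.
    by have H := generation_mean n; exact H.
  apply: (@le_lt_trans _ _ ((1 - alpha)^-1)%:E); last exact: ltry.
  apply: lime_le; first by apply: is_cvg_nneseries => n _ _; rewrite lee_fin exprn_ge0.
  (* Multiplied by [1 - alpha], the partial sum telescopes to [1 - alpha ^+ n], which is at most
     1. *)
  apply: nearW => n; rewrite sumEFin lee_fin -[leRHS]mul1r ler_pdivlMr ?subr_gt0//.
  rewrite mulrC big_mkord -opprB mulNr -subrX1 opprB.
  by rewrite gerBl exprn_ge0.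
apply: filterS (integrable_ae measurableT intS) => w /(_ I).
by rewrite ge0_fin_numE.
Qed.

End generations.
End clusters.

(** * Local finiteness of the renewal process *)

Section renewal.
Context d (Omega : measurableType d) (R : realType) (P : probability Omega R).
Variables (tau : nat -> {RV P >-> R}) (F : R -> R).
Hypothesis tau_pos : forall n, {ae P, forall w, (0 < tau n w)%R}.
Hypothesis tau_indep : mutually_independent P [set: nat]
  (fun n => g_sigma_algebra_preimage (tau n)).
Hypothesis tau_cdf : forall n (x : R), cdf (tau n) x = (F x)%:E.

(** Otherwise [F] is 1 at every 1/(n+1), so that the first waiting time is almost surely at most 0,
    against its positivity. *)
Lemma cdf_lt1_near0 : exists2 e, (0 < e)%R & (F e < 1)%R.
Proof.
apply: contrapT => noe.
have taule n : {ae P, forall w, (tau 0%N w <= n.+1%:R^-1)%R}.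
  have F1 : cdf (tau 0%N) n.+1%:R^-1%R = 1.
    rewrite tau_cdf; apply/eqP; rewrite eq_le -(tau_cdf 0%N) cdf_le1 tau_cdf lee_fin leNgt.
    by apply/negP => F1; apply: noe; exists (n.+1%:R^-1)%R.
  have mA : measurable (tau 0%N @^-1` `]-oo, n.+1%:R^-1%R]).
    by rewrite -[X in measurable X]setTI; exact: measurable_funPT.
  exists (~` (tau 0%N @^-1` `]-oo, n.+1%:R^-1%R])); split.
  - exact: measurableC.
  - by apply: etrans (probability_setC P mA) _; rewrite [X in 1 - X]F1 subee.
  - by move=> w /=; rewrite in_itv/=.
have : {ae P, forall w, False}.
  apply: filterS2 (tau_pos 0%N) (ae_foralln taule) => w tau0 tauw.
  have /ltr_add_invr[k] := tau0; rewrite add0r => /lt_le_trans /(_ (tauw k)).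
  by rewrite ltxx.
(* An almost sure contradiction would make the whole space null. *)
rewrite /= => -[A [mA PA AT]]; have : P setT = 0.
  by apply: subset_measure0 PA => // w _; exact: AT.
by rewrite probability_setT => /eqP; rewrite onee_eq0.
Qed.

(** By independence, [k] consecutive waiting times are all at most [e] with probability [F e ^+ k],
    which tends to 0; hence it is a null event that all the waiting times from [m] on are at most
    [e]. *)
Lemma infinitely_often_gt e : (F e < 1)%R ->
  {ae P, forall w, forall m, exists2 n, (m <= n)%N & (e < tau n w)%R}.
Proof.
move=> Fe1; apply/ae_foralln => m.
have mA n : measurable (tau n @^-1` `]-oo, e]).
  by rewrite -[X in measurable X]setTI; exact: measurable_funPT.
pose B := \bigcap_(n in [set n | (m <= n)%N]) (tau n @^-1` `]-oo, e]).
have mB : measurable B by exact: bigcap_measurableType.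
have Fe0 : (0 <= F e)%R by rewrite -lee_fin -(tau_cdf 0%N) cdf_ge0.
have PB k : P B <= (F e ^+ k)%:E.
  have PI : P (\bigcap_(i in [set` iota m k]) (tau i @^-1` `]-oo, e])) =
      \prod_(i <- iota m k) P (tau i @^-1` `]-oo, e]).
    apply: tau_indep => [|n _]; first exact: iota_uniq.
    split => //; exists `]-oo, e]%classic; first exact: measurable_itv.
    by rewrite setTI.
  apply: (@le_trans _ _ (P (\bigcap_(i in [set` iota m k]) (tau i @^-1` `]-oo, e])))).
    apply: le_measure; rewrite ?inE//.
      by exact: bigcap_measurableType.
    by move=> w Bw n; rewrite /= mem_iota => /andP[mn _]; exact: Bw.
  rewrite PI (eq_bigr (fun=> (F e)%:E)); last by move=> n _; exact: tau_cdf.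
  by rewrite prodEFin big_const_seq count_predT size_iota iter_mulr_1.
have PB0 : P B = 0.
  apply/eqP; rewrite eq_le measure_ge0 andbT.
  have : (fun k => (F e ^+ k)%:E) @ \oo --> 0.
    by apply: cvg_EFin; [exact: nearW|apply: cvg_expr; rewrite ger0_norm].
  by move/cvge_to_ge; apply; apply: nearW => k; exact: PB.
exists B; split => // w /= noexc n mn /=; rewrite in_itv/= leNgt; apply/negP => etau.
by apply: noexc; exists n.
Qed.

(** The epochs are nondecreasing and gain more than [e] infinitely often, so that they pass every
    multiple of [e]. *)
Lemma epoch_unbounded : {ae P, forall w, forall b, exists N, forall n, (N <= n)%N ->
  (b < epoch tau n w)%R}.
Proof.
have [e e0 /infinitely_often_gt io] := cdf_lt1_near0.
apply: filterS2 io (ae_foralln tau_pos) => w io tau0 b.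
have nd : {homo (epoch tau ^~ w) : n m / (n <= m)%N >-> (n <= m)%R}.
  apply/nondecreasing_seqP => n.
  by rewrite /epoch big_ord_recr/= lerDl ltW.
have reach j : exists N, (j%:R * e <= epoch tau N w)%R.
  elim: j => [|j [N jN]]; first by exists 0%N; rewrite mul0r /epoch big_ord0.
  have [n Nn en] := io N; exists n.+1.
  rewrite /epoch big_ord_recr/= -natr1 mulrDl mul1r lerD//; last exact: ltW.
  exact: le_trans jN (nd _ _ Nn).
(* The successor of the truncation of [b / e] exceeds [b / e], so this multiple of [e] exceeds
   [b]. *)
have [N bN] := reach (Num.truncn (b / e)).+1.
exists N => n Nn; apply: lt_le_trans (nd _ _ Nn); apply: lt_le_trans bN.
by rewrite -ltr_pdivrMr// truncnS_gt.
Qed.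

Lemma renewal_process_lty : {ae P, forall w, forall b : R,
  renewal_process tau w `]-oo, b]%classic < +oo}.
Proof.
apply: filterS epoch_unbounded => w unb b; have [N bN] := unb b.
apply: (@nneseries_lty _ _ N) => k.
- by rewrite /= diracE lee_fin.
- by rewrite /= diracE ltry.
- by move=> Nk; rewrite /= diracE memNset//= in_itv/= leNgt bN.
Qed.

Lemma renewal_process_lt0 : {ae P, forall w,
  renewal_process tau w `]-oo, 0%R[%classic = 0}.
Proof.
apply: filterS (ae_foralln tau_pos) => w tau0.
apply: eseries0 => k _ _; rewrite /= diracE memNset//= in_itv/= ltNge.
by apply/negP; rewrite negbK; apply: sumr_ge0 => i _; exact: ltW.
Qed.

Lemma measurable_renewal_process : measurable_fun setT (renewal_process tau).
Proof.
have mepoch n : measurable_fun setT (epoch tau n) by exact: measurable_sum.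
apply: measurable_fun_measures => B mB.
apply: ge0_emeasurable_sum => // n _.
under eq_fun do rewrite /= diracE.
apply/measurable_EFinP.
rewrite (_ : (fun _ => _) = \1_(epoch tau n @^-1` B)); last first.
  by apply/funext => w; rewrite indicE; congr (_%:R)%R; congr nat_of_bool;
    apply/idP/idP; rewrite !inE.
apply: measurable_indic; rewrite -[X in measurable X]setTI; exact: mepoch.
Qed.

End renewal.

(** * Existence of the cluster process *)

Lemma measurable_mseries_measures d (Omega : measurableType d) (R : realType)
    (M : nat -> Omega -> measures R) : (forall n, measurable_fun setT (M n)) ->
  measurable_fun setT (fun w => mseries (fun n => M n w) 0 : measures R).
Proof.
move=> mM; apply: measurable_fun_measures => B mB.
apply: ge0_emeasurable_sum => // n _.
exact: (measurableT_comp (measurable_measures_ev mB) (mM n)).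
Qed.

Theorem corollary4p2 (R : realType) (d : measure_display)
  (Omega : measurableType d) (P : probability Omega R)
  (h : R -> R)
  (hm : measurable_fun (`[0%R, +oo[ : set R) h)
  (h0 : forall x : R, (0 <= x)%R -> (0 <= h x)%R)
  (halpha : \int[lebesgue_measure]_(x in `[0%R, +oo[) (h x)%:E < 1)
  (tau : nat -> {RV P >-> R}) (m : R) (F f : R -> R)
  (tau_pos : forall n, {ae P, forall w, (0 < tau n w)%R})
  (tau_indep : mutually_independent P [set: nat]
     (fun n => g_sigma_algebra_preimage (tau n)))
  (tau_cdf : forall n (x : R), cdf (tau n) x = (F x)%:E)
  (tau_mean : forall n, 'E_P[tau n] = (m^-1)%:E)
  (fm : measurable_fun [set: R] f)
  (f0 : forall x : R, (0 <= f x)%R)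
  (F_density : forall x : R, (F x)%:E =
     \int[lebesgue_measure]_(y in `]-oo, x]) (f y)%:E)
  (Ns : nat -> R -> Omega -> measures R)
  (Ns_offspring : offspring_families P h Ns)
  (NR_indep : independent2 P
     (g_sigma_algebra_preimage (renewal_process tau))
     (sigma_family [set nt : nat * R | (0 < nt.1)%N /\ (0 <= nt.2)%R]
        (fun nt => Ns nt.1 nt.2)))
  (Nc : nat -> R -> Omega -> measures R)
  (Nc_generations : forall t0 : R, (0 <= t0)%R ->
     cluster_generations P Ns t0 (fun n => Nc n t0))
  (N : Omega -> measures R)
  (N_cluster : cluster_process P (renewal_process tau) Nc N) :
  (forall B : set R, measurable B -> bounded_set B ->
     {ae P, forall w, N w B < +oo}) /\
  (forall t0 : R, (0 <= t0)%R ->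
     {ae P, forall w, whole_cluster Nc t0 w `[0%R, +oo[%classic < +oo}).
Proof.
have whole_finite t0 : (0 <= t0)%R ->
    {ae P, forall w, whole_cluster Nc t0 w setT < +oo}.
  by move=> t00; apply: (cluster_finite hm h0 halpha Ns_offspring t00 (Nc_generations _ t00)).
have whole_before t0 : (0 <= t0)%R ->
    {ae P, forall w, whole_cluster Nc t0 w `]-oo, t0[%classic = 0}.
  by move=> t00; apply: (cluster_before Ns_offspring t00 (Nc_generations _ t00)).
have measurable_whole t0 : (0 <= t0)%R -> measurable_fun setT (whole_cluster Nc t0).
  by move=> /Nc_generations[mNc _ _]; exact: measurable_mseries_measures.
split=> [B mB [M0 [_ BM]]|t0 /whole_finite]; last first.
  apply: filterS => w; apply: le_lt_trans.
  by apply: le_measure; rewrite ?inE.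
(* Every number above [M0] bounds [B], hence the strict excess over [M0]; nonnegativity of [b]
   ensures that the centres beyond [b] are admissible immigrants. *)
pose b := (Num.max M0 0 + 1)%R.
have b0 : (0 <= b)%R by rewrite addr_ge0// le_max lexx orbT.
have M0b : (M0 < b)%R by rewrite ltr_pwDr// le_max lexx.
have Bb : B `<=` `]-oo, b].
  by move=> x Bx; rewrite /= in_itv/=; apply: le_trans (ler_norm _) (BM _ M0b _ Bx).
have mb : measurable (`]-oo, b] : set R) by [].
have [mN [X [M supN]]] := N_cluster.
have sG : sigma_algebra setT (g_sigma_algebra_preimage (renewal_process tau)).
  exact/sigma_algebra_preimage/sigma_algebra_measurable.
have mG : g_sigma_algebra_preimage (renewal_process tau) `<=` measurable.
  by move=> _ [E mE <-]; apply: measurable_renewal_process.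
(* The centres are almost surely nonnegative, and a cluster attached to such a centre is almost
   surely finite. *)
have finite_attached k : {ae P, forall w, M k w setT < +oo}.
  have mE : measurable [set mu : measures R | mu setT = +oo].
    exact: (measurable_measures_preimage measurableT (E := [set _])).
  have n1 : P.-negligible (~` located X k (~` `[0%R, +oo[) `&`
      M k @^-1` [set mu | mu setT = +oo]).
    apply: (attached_negligible sG mG supN) => //= t.
    rewrite /= in_itv/= andbT => t0; apply: measure_negligible.
      by rewrite -[X in measurable X]setTI; exact: measurable_whole.
    by apply: negligibleS (whole_finite _ t0) => w /= ->; rewrite ltxx.
  have n2 : P.-negligible (located X k (~` `[0%R, +oo[)).
    apply: (centre_located_negligible supN); first exact: measurableC.
    by rewrite setCitvr; exact: renewal_process_lt0.
  apply: negligibleS (negligibleU n1 n2) => w /= /negP.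
  rewrite -leNgt leye_eq => /eqP MT.
  by have [L|L] := pselect (located X k (~` `[0%R, +oo[) w); [right|left].
(* If the centre is not in []-oo, b]], it is absent or some [t] beyond [b]; in the latter case the
   cluster is almost surely carried by [[t, +oo[]. *)
have late_attached k : {ae P, forall w,
    ~ located X k `]-oo, b] w -> M k w `]-oo, b]%classic = 0}.
  have mE := measurable_measures_neq0 mb.
  have n1 : P.-negligible (~` located X k (~` `]b, +oo[) `&`
      M k @^-1` [set mu | mu `]-oo, b]%classic != 0]).
    apply: (attached_negligible sG mG supN) => //= [|t]; first by rewrite eqxx.
    rewrite /= in_itv/= andbT => bt; have t0 := le_trans b0 (ltW bt).
    apply: measure_negligible.
      by rewrite -[X in measurable X]setTI; exact: measurable_whole.
    apply: negligibleS (whole_before _ t0) => w /= /eqP Kb Kt; apply: Kb.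
    apply: subset_measure0 Kt => //; apply: subset_itvl; rewrite bnd_simp//.
  apply: negligibleS n1 => w /= /not_implyP[nL /eqP Mb].
  by rewrite setCitvr; split.
have NR_finite := renewal_process_lty tau_pos tau_indep tau_cdf.
have [_ _ _ _ NM] := supN.
have {}finite_attached := ae_foralln finite_attached.
have {}late_attached := ae_foralln late_attached.
have ae_count := centre_count supN mb.
apply: filterS2 NM (filterI (filterI finite_attached late_attached)
  (filterI NR_finite ae_count)) => w NM [[Mfin Mlate] [/(_ b) NRb count]].
apply: (@le_lt_trans _ _ (N w `]-oo, b]%classic)); first by apply: le_measure; rewrite ?inE.
rewrite count in NRb.
(* The renewal process has finitely many points up to [b], so from some index [n] on no centre lies
   there: the mass of [N] on []-oo, b]] reduces to finitely many finite terms. *)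
have [n nP] := nneseries_bool_eventually0 (p := fun k => w \in located X k `]-oo, b]) NRb.
rewrite (NM _ mb); apply: (@nneseries_lty _ _ n) => k //.
  by apply: le_lt_trans (Mfin k); apply: le_measure; rewrite ?inE.
by move=> /nP /negP kL; apply: Mlate => Lk; apply: kL; rewrite inE.
Qed.
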